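(* Let $f(x)=x+\frac12M(x)x$ be a bijective quadratic map of $\mathbb{R}^n$, where $M$ is a linear function from $\mathbb{R}^n$ to real $n\times n$ matrices satisfying $M(x)y=M(y)x$ for all $x,y\in\mathbb{R}^n$. Then the following statements are equivalent: (i) $f^{-1}$ is a quadratic map. (ii) $M(x)^2x=0$ for all $x\in\mathbb{R}^n$. (iii) $M(x)M(y)z+M(y)M(z)x+M(z)M(x)y=0$ for all $x,y,z\in\mathbb{R}^n$. (iv) $f^k(x)=x+\frac k2M(x)x$ for all $k\in\mathbb{Z}$ and all $x\in\mathbb{R}^n$.
   Context: A map $\mathbb{R}^n\to\mathbb{R}^n$ is quadratic if its components are real polynomials of degree at most $2$. $f^k$ denotes the $k$-th iterate of $f$ (for negative $k$, the $|k|$-th iterate of $f^{-1}$). *)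

(* Defs.v *)
From HB Require Import structures.
From mathcomp Require Import all_boot all_order all_algebra.
From mathcomp Require Import reals mpoly.
Set Implicit Arguments.
Unset Strict Implicit.
Unset Printing Implicit Defensive.
Import Order.TTheory GRing.Theory Num.Theory.
Local Open Scope ring_scope.

(* [msize p] is the total degree plus one, and [msize 0 = 0]. *)
Definition quadratic_map (R : realType) (n : nat)
    (g : 'cV[R]_n -> 'cV[R]_n) : Prop :=
  exists p : 'I_n -> {mpoly R[n]},
    (forall i, (msize (p i) <= 3)%N) /\
    (forall x i, g x i 0 = (p i).@[fun j => x j 0]).

(* [Negz m] denotes [- m.+1]; [finv] is meant to be the inverse of [f]. *)
Definition iterz (T : Type) (f finv : T -> T) (k : int) : T -> T :=
  match k with
  | Posz m => iter m f
  | Negz m => iter m.+1 finv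
  end.

(* Main.v *)
(* Write [q x = M x *m x / 2], so that [f (t x) = t x + t^2 q x].  If the
   inverse [g] is quadratic, its restriction to the plane spanned by [x] and
   [q x] is a polynomial of degree 2, and comparing coefficients of [t] in
   [g (t x + t^2 q x) = t x] gives
   [g (s x + u q x) = s x + (u - s^2) g (q x)].  Using this formula at [q x]
   as well yields [g (q x) = q x], hence [g = id - q], and the formula then
   forces [M x *m q x = 0].  The equivalence of (ii) and (iii) is
   polarization.  Under (iii), [q] is constant along the maps
   [x |-> x + c q x], so that these form a one-parameter group. *)
Require Import Defs.
From HB Require Import structures.
From mathcomp Require Import all_boot all_order all_algebra.
From mathcomp Require Import reals mpoly.
From mathcomp Require Import ring lra.
Set Implicit Arguments.
Unset Strict Implicit.
Unset Printing Implicit Defensive.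
Import Order.TTheory GRing.Theory Num.Theory.
Local Open Scope ring_scope.

Lemma mdeg_le2P (n : nat) (m : 'X_{1..n}) : (mdeg m <= 2)%N ->
  [\/ m = 0%MM, exists i, m = U_(i)%MM | exists i j, m = (U_(i) + U_(j))%MM].
Proof.
have [/eqP|m_gt0] := posnP (mdeg m).
  by rewrite mdeg_eq0 => /eqP -> _; constructor 1.
have [i mi] : exists i, m i != 0%N.
  apply/existsP; rewrite -negb_forall; apply/negP => /forallP m0.
  move: m_gt0; rewrite mdegE big1 // => i _; exact/eqP/m0.
have mE : m = (m - U_(i) + U_(i))%MM by rewrite submK // lep1mP.
rewrite mE mdegD mdeg1 addn1 ltnS leq_eqVlt ltnS leqn0 => /orP[|].
  by move=> /mdeg1P[j /eqP ->]; constructor 3; exists j, i.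
rewrite mdeg_eq0 => /eqP ->; constructor 2; exists i; exact: add0m.
Qed.

(** This form is stable under sums, so the monomials of degree at most 2 suffice. The coefficients
    do not depend on [s] and [u] and can be compared later. *)
Lemma meval_plane (R : comNzRingType) (n : nat) (p : {mpoly R[n]})
    (x y : 'I_n -> R) : (msize p <= 3)%N ->
  exists a b c d e k : R, forall s u : R,
    p.@[fun j => s * x j + u * y j] =
    a + b * s + c * u + d * s ^+ 2 + e * (s * u) + k * u ^+ 2.
Proof.
move=> p3; rewrite (mpolyE p) big_seq.
elim/big_ind: _ => [|p1 p2 h1 h2|m mp].
- by exists 0, 0, 0, 0, 0, 0 => s u; rewrite meval0; ring.
- have [a [b [c [d [e [k E]]]]]] := h1.
  have [a' [b' [c' [d' [e' [k' E']]]]]] := h2.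
  exists (a + a'), (b + b'), (c + c'), (d + d'), (e + e'), (k + k') => s u.
  by rewrite mevalD E E'; ring.
set z := p@_m.
have /mdeg_le2P : (mdeg m <= 2)%N.
  by rewrite -ltnS (leq_trans (msize_mdeg_lt mp)).
case=> [->|[i ->]|[i [j ->]]].
- by exists z, 0, 0, 0, 0, 0 => s u; rewrite mevalZ mpolyX0 meval1; ring.
- exists 0, (z * x i), (z * y i), 0, 0, 0 => s u.
  by rewrite mevalZ mevalXU; ring.
- exists 0, 0, 0, (z * (x i * x j)), (z * (x i * y j + x j * y i)),
    (z * (y i * y j)) => s u.
  by rewrite mevalZ mpolyXD mevalM !mevalXU; ring.
Qed.

Lemma quadratic_map_parabola (R : realType) (n : nat)
    (g : 'cV[R]_n -> 'cV[R]_n) (x y : 'cV[R]_n) :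
  quadratic_map g ->
  (forall t, g (t *: x + t ^+ 2 *: y) = t *: x) ->
  forall s u, g (s *: x + u *: y) = s *: x + (u - s ^+ 2) *: g y.
Proof.
move=> [p [p3 gE]] gxy s u; apply/matrixP => i j; rewrite (ord1 j).
have [a [b [c [d [e [k E]]]]]] :=
  meval_plane (fun j => x j 0) (fun j => y j 0) (p3 i).
have gplane s' u' : g (s' *: x + u' *: y) i 0 =
    a + b * s' + c * u' + d * s' ^+ 2 + e * (s' * u') + k * u' ^+ 2.
  by rewrite gE -E; apply: meval_eq => l; rewrite !mxE.
have coefs t : a + b * t + c * t ^+ 2 + d * t ^+ 2 + e * (t * t ^+ 2)
    + k * (t ^+ 2) ^+ 2 = t * x i 0.
  by rewrite -gplane gxy mxE.
have gy : g y i 0 = a + c + k.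
  by have := gplane 0 1; rewrite scale0r add0r scale1r => ->; ring.
rewrite gplane !mxE gy.
(* [coefs] equates polynomials of degree at most 4 in [t]; five values of [t] determine all
   coefficients, where [c] and [d] only enter through [c + d]. *)
have := coefs 0; have := coefs 1; have := coefs (-1).
have := coefs 2; have := coefs (-2).
move=> h1 h2 h3 h4 h5.
have a0 : a = 0 by lra.
have k0 : k = 0 by lra.
have e0 : e = 0 by lra.
have dc : d = - c by lra.
have bx : b = x i 0 by lra.
by rewrite a0 k0 e0 dc bx; ring.
Qed.

Section SymmetricBilinear.

Variables (R : realType) (n : nat) (M : {linear 'cV[R]_n -> 'M[R]_n}).
Hypothesis M_sym : forall x y : 'cV[R]_n, M x *m y = M y *m x.

Let q (x : 'cV[R]_n) : 'cV[R]_n := 2^-1 *: (M x *m x).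

Lemma half_quadZ (a : R) x : q (a *: x) = a ^+ 2 *: q x.
Proof.
by rewrite /q [M (_ *: _)]linearZ /= -scalemxAl -scalemxAr !scalerA; congr (_ *: _); ring.
Qed.

Lemma half_quadD x y : q (x + y) = q x + M x *m y + q y.
Proof.
rewrite /q [M (_ + _)]linearD /= mulmxDl !mulmxDr (M_sym y x) !scalerDr -!addrA.
congr (_ + _); rewrite !addrA -scalerDl.
by rewrite -[2^-1 + _](_ : 1 = _) ?scale1r //; lra.
Qed.

Lemma quadratic_inverse_cube (f finv : 'cV[R]_n -> 'cV[R]_n) :
  (forall x, f x = x + q x) -> cancel f finv -> quadratic_map finv ->
  forall x, M x *m q x = 0.
Proof.
move=> fE fK quad.
have plane x s u :
    finv (s *: x + u *: q x) = s *: x + (u - s ^+ 2) *: finv (q x).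
  apply: quadratic_map_parabola => // t.
  by rewrite -half_quadZ -fE fK.
have ray x u : finv (u *: q x) = u *: finv (q x).
  by have := plane x 0 u; rewrite scale0r !add0r expr0n subr0.
have line x s : finv (s *: x) = s *: x - s ^+ 2 *: finv (q x).
  by have := plane x s 0; rewrite scale0r addr0 sub0r scaleNr.
(* Put [F = finv (q (q x))]. By [line], [finv (q x) = q x - F] and
   [finv (2 *: q x) = 2 *: q x - 4 *: F]; by [ray] the latter is twice the former, so [F = 0]. *)
have fixq x : finv (q x) = q x.
  have E1 := line (q x) 1.
  have E2 := line (q x) 2.
  move: E2; rewrite ray; move: E1; rewrite !scale1r expr1n scale1r => ->.
  move=> /matrixP E; apply/matrixP => i j; have := E i j; rewrite !mxE.
  lra.
have finvE x : finv x = x - q x.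
  by have := line x 1; rewrite !scale1r expr1n scale1r fixq.
have qq0 x : q (q x) = 0.
  by apply: oppr_inj; apply: (addrI (q x)); rewrite -finvE fixq oppr0 addr0.
(* Here [finv (x + q x) = x], while expanding [x + q x - q (x + q x)] gives [x - M x *m q x]. *)
move=> x; have := plane x 1 1.
rewrite !scale1r expr1n subrr scale0r addr0 finvE half_quadD qq0 addr0.
by move=> /eqP; rewrite opprD addrA addrK -subr_eq0 addrAC subrr sub0r
  oppr_eq0 => /eqP.
Qed.

(** The alternating sum of the cubic map over the sums of nonempty subsets of [x], [y], [z] isolates
    its trilinear part, which by [M_sym] is twice the cyclic sum. *)
Lemma cube_polarization :
  (forall x, M x *m (M x *m x) = 0) ->
  forall x y z, M x *m (M y *m z) + M y *m (M z *m x) + M z *m (M x *m y) = 0.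
Proof.
move=> cube0 x y z.
have := cube0 (x + y + z); have := cube0 (x + y); have := cube0 (y + z).
have := cube0 (x + z); have := cube0 x; have := cube0 y; have := cube0 z.
rewrite !linearD /= !mulmxDl !mulmxDr.
rewrite (M_sym y x) (M_sym z x) (M_sym z y).
move=> /matrixP h1 /matrixP h2 /matrixP h3 /matrixP h4 /matrixP h5 /matrixP h6.
move=> /matrixP h7; apply/matrixP => i j.
move: (h1 i j) (h2 i j) (h3 i j) (h4 i j) (h5 i j) (h6 i j) (h7 i j).
rewrite !mxE; lra.
Qed.

(** The left side is [q x + c *: (M x *m q x) + c ^+ 2 *: q (q x)], and both corrections vanish. *)
Lemma half_quad_shift :
  (forall x y z, M x *m (M y *m z) + M y *m (M z *m x) + M z *m (M x *m y) = 0) ->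
  forall x (c : R), q (x + c *: q x) = q x.
Proof.
move=> cyc x c.
have cube0 : M x *m (M x *m x) = 0.
  have := cyc x x x => /matrixP E; apply/matrixP => i j.
  have := E i j; rewrite !mxE; lra.
(* With [w = M x *m x] as third argument, the first two cyclic terms contain [M x *m w = 0], which
   leaves [M w *m w]. *)
have quart0 : M (M x *m x) *m (M x *m x) = 0.
  have := cyc x x (M x *m x).
  by rewrite (M_sym (M x *m x) x) cube0 !mulmx0 !add0r.
rewrite half_quadD half_quadZ -scalemxAr /q -scalemxAr cube0 !scaler0 addr0.
by rewrite [M (_ *: _)]linearZ /= -scalemxAl -scalemxAr quart0 !scaler0 addr0.
Qed.

Lemma quadratic_map_half_quad (c : R) :
  quadratic_map (fun x : 'cV[R]_n => x + c *: (M x *m x)).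
Proof.
(* By linearity, entry [(i, k)] of [M x] is the sum over [l] of [x l 0] times that entry of
   [M (delta_mx l 0)]. *)
exists (fun i => 'X_i + c *:
  \sum_k \sum_l (M (delta_mx l 0) i k *: 'X_[U_(l) + U_(k)])).
split=> [i|x i].
  apply: (leq_trans (msizeD_le _ _)); rewrite geq_max msizeX mdeg1 /=.
  apply: (leq_trans (msizeZ_le _ _)); apply: (leq_trans (msize_sum _ _ _)).
  apply/bigmax_leqP => k _; apply: (leq_trans (msize_sum _ _ _)).
  apply/bigmax_leqP => l _; apply: (leq_trans (msizeZ_le _ _)).
  by rewrite msizeX mdegD !mdeg1.
rewrite mevalD mevalXU mevalZ !mxE; congr (_ + _ * _).
rewrite raddf_sum; apply: eq_bigr => k _; rewrite raddf_sum.
have {1}-> : x = \sum_l x l 0 *: delta_mx l 0.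
  by rewrite {1}[x]matrix_sum_delta; apply: eq_bigr => l _; rewrite big_ord1.
rewrite linear_sum summxE mulr_suml; apply: eq_bigr => l _.
by rewrite linearZ mxE /= mevalZ mpolyXD mevalM !mevalXU; ring.
Qed.

End SymmetricBilinear.

Theorem lemma2p2 (R : realType) (n : nat)
    (M : {linear 'cV[R]_n -> 'M[R]_n})
    (M_sym : forall x y : 'cV[R]_n, M x *m y = M y *m x)
    (f finv : 'cV[R]_n -> 'cV[R]_n)
    (f_def : forall x : 'cV[R]_n, f x = x + 2^-1 *: (M x *m x))
    (fK : cancel f finv) (finvK : cancel finv f) :
  [<-> quadratic_map finv;
       forall x : 'cV[R]_n, M x ^+ 2 *m x = 0;
       forall x y z : 'cV[R]_n,
         M x *m M y *m z + M y *m M z *m x + M z *m M x *m y = 0;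
       forall (k : int) (x : 'cV[R]_n),
         iterz f finv k x = x + (k%:~R / 2) *: (M x *m x)].
Proof.
tfae.
- move=> quad x; have := quadratic_inverse_cube M_sym f_def fK quad x.
  rewrite -scalemxAr => /eqP; rewrite scaler_eq0 invr_eq0 pnatr_eq0 /=.
  by move/eqP; rewrite mulmxA.
- move=> sq0 x y z; rewrite -!mulmxA; apply: cube_polarization => // v.
  by rewrite mulmxA; exact: sq0.
- move=> cyc.
  pose g (c : R) x := x + c *: (2^-1 *: (M x *m x)).
  have gD c d x : g c (g d x) = g (c + d) x.
    rewrite {1}/g half_quad_shift // => [|u v w]; last by rewrite !mulmxA.
    by rewrite /g -addrA -scalerDl [d + c]addrC.
  have g0 x : g 0 x = x by rewrite /g scale0r addr0.
  have f_g x : f x = g 1 x by rewrite f_def /g scale1r.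
  (* Since [x = g 1 (g (-1) x) = f (g (-1) x)], applying [finv] gives the claim. *)
  have finv_g x : finv x = g (-1) x.
    by rewrite -{1}[x]g0 -[0](subrr 1) -gD -f_g fK.
  have iter_g (h : 'cV[R]_n -> 'cV[R]_n) c : h =1 g c ->
      forall m x, iter m h x = g (m%:R * c) x.
    move=> hE; elim=> [|m IHm] x /=; first by rewrite mul0r g0.
    by rewrite hE IHm gD -[in RHS]natr1 mulrDl mul1r addrC.
  move=> k x; rewrite -scalerA -/(g k%:~R x); case: k => m.
    by rewrite /iterz (iter_g _ _ f_g) mulr1.
  by rewrite /iterz (iter_g _ _ finv_g) mulrN1 NegzE mulrNz.
- move=> it.
  have [p [p3 pE]] := quadratic_map_half_quad M (- 2^-1).
  exists p; split=> // x i; rewrite -pE.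
  (* [Negz 0] is [-1], for which [iterz] is a single [finv]. *)
  have := it (Negz 0) x; rewrite /iterz /= => ->.
  by rewrite NegzE mulrNz mulN1r.
Qed.
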